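(* Let $f(z)=1+\sum_{n=1}^{\infty}a_{n}z^{n}$ and $g(z)=1+\sum_{n=1}^{\infty}b_{n}z^{n}$ be (formal) power series with real coefficients such that $g(z)=1/f(-z)$. Then the Toeplitz matrix $T[f]$ is totally positive if and only if the Toeplitz matrix $T[g]$ is totally positive.
   Context: For a power series $f(z)=\sum_{n=0}^{\infty}a_{n}z^{n}$ with real coefficients, the Toeplitz matrix $T[f]$ is the infinite matrix indexed by pairs of integers $(i,j)\in\mathbb{Z}\times\mathbb{Z}$ with entries $T[f]_{ij}=a_{j-i}$ if $j-i\geq 0$ and $T[f]_{ij}=0$ if $j-i<0$. A minor of order $k$ ($k\ge 1$) of $T[f]$ is the determinant of the $k\times k$ submatrix supported on rows $i_1<\cdots<i_k$ and columns $j_1<\cdots<j_k$ (integers). The matrix $T[f]$ is totally positive when every minor of $T[f]$, of every finite order, is nonnegative. *)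

(* Defs.v *)
From HB Require Import structures.
From mathcomp Require Import all_boot all_order all_algebra.
From mathcomp Require Import reals.

Set Implicit Arguments.
Unset Strict Implicit.
Unset Printing Implicit Defensive.

Import Order.TTheory GRing.Theory Num.Theory.
Local Open Scope ring_scope.

(* A formal power series over R is represented by its coefficient sequence. *)
Definition fps (R : Type) : Type := nat -> R.

Definition fps_one (R : realType) : fps R := fun n => (n == 0%N)%:R.

Definition fps_mul (R : realType) (f g : fps R) : fps R :=
  fun n => \sum_(i < n.+1) f i * g (n - i)%N.

(* The series f(-z). *)
Definition fps_reflect (R : realType) (f : fps R) : fps R :=
  fun n => (-1) ^+ n * f n.

(* g = 1/h in the ring of formal power series; such a g is unique. *)
Definition fps_is_inv (R : realType) (g h : fps R) : Prop :=
  fps_mul g h =1 @fps_one R.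

(* Under the guard, `|j - i| is j - i as a natural number. *)
Definition toeplitz (R : realType) (f : fps R) (i j : int) : R :=
  if 0 <= j - i then f `|j - i|%N else 0.

Definition increasing (k : nat) (s : 'I_k -> int) : Prop :=
  forall p q : 'I_k, (p < q)%N -> s p < s q.

Definition minor (R : realType) (A : int -> int -> R) (k : nat)
    (r c : 'I_k -> int) : R :=
  \det (\matrix_(p < k, q < k) A (r p) (c q)).

Definition totally_positive (R : realType) (A : int -> int -> R) : Prop :=
  forall (k : nat) (r c : 'I_k -> int), (0 < k)%N ->
    increasing r -> increasing c -> 0 <= minor A r c.

(* Main.v *)
(* Finite sections of T[g] and T[f(-z)] on a window of consecutive integers are
   mutually inverse unitriangular matrices, so by Jacobi's identity the minor of
   T[g] on rows I and columns J is, up to sign, the minor of T[f(-z)] on rows J^c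
   and columns I^c (complements in the window). The checkerboard signs of f(-z)
   cancel the sign of Jacobi's identity, which leaves the minor of T[f] on the
   same rows and columns. The relation between f and g is symmetric. *)
Require Import Defs.
From mathcomp Require Import all_boot all_order all_algebra.
From mathcomp Require Import all_fingroup zify ring.
From mathcomp Require Import reals.

Set Implicit Arguments.
Unset Strict Implicit.
Unset Printing Implicit Defensive.

Import Order.TTheory GRing.Theory Num.Theory.
Local Open Scope ring_scope.

(** * Signs of permutations and shuffles, and Jacobi's identity *)

Lemma sgr_natB (R : realDomainType) (i j : nat) :
  i != j -> Num.sg (j%:R - i%:R : R) = (-1) ^+ (j < i)%N.
Proof.
move=> ij; rewrite -neqr0_sign; first by rewrite subr_lt0 ltr_nat.
by rewrite subr_eq0 eqr_nat eq_sym.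
Qed.

(* Permuting the columns of the Vandermonde matrix on the nodes 0, ..., n - 1
   multiplies its determinant by the sign of the permutation. *)
Lemma sign_perm_inversions (R : realDomainType) (n : nat) (s : 'S_n) :
  (-1) ^+ s = \prod_(i < n) \prod_(j < n | (i < j)%N) (-1) ^+ (s j < s i)%N :> R.
Proof.
pose V (t : 'S_n) : R := \prod_(i < n) \prod_(j < n | (i < j)%N)
  ((t j)%:R - (t i)%:R).
have V_det t : V t = \det (Vandermonde n (\row_(i < n) (t i)%:R : 'rV[R]_n)).
  rewrite det_Vandermonde; apply: eq_bigr => i _; apply: eq_bigr => j _.
  by rewrite !mxE.
(* Taking [Num.sg] discards the sizes of the differences and leaves one factor -1 per inversion. *)
have sgV t : Num.sg (V t) =
    \prod_(i < n) \prod_(j < n | (i < j)%N) (-1) ^+ (t j < t i)%N.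
  rewrite (big_morph _ (@sgrM R) (@sgr1 R)); apply: eq_bigr => i _.
  rewrite (big_morph _ (@sgrM R) (@sgr1 R)); apply: eq_bigr => j ij.
  by rewrite sgr_natB // (inj_eq val_inj) (inj_eq perm_inj) -(inj_eq val_inj) ltn_eqF.
have sgV1 : Num.sg (V 1%g) = 1.
  rewrite sgV big1 // => i _; rewrite big1 // => j ij.
  by rewrite !perm1 ltnNge (ltnW ij).
rewrite -sgV; suff -> : V s = (-1) ^+ s * V 1%g.
  by rewrite sgrM sgV1 mulr1; case: (odd_perm s); rewrite ?sgrN sgr1.
rewrite !V_det -det_perm -[LHS]det_tr -[X in _ = _ * X]det_tr.
by rewrite -det_mulmx -row_permE; congr (\det _); apply/matrixP => i j; rewrite !mxE perm1.
Qed.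

Lemma prod_sign_ltn (R : comPzRingType) (n : nat) (y : 'I_n) :
  \prod_(x < n | x != y) (-1) ^+ (x < y)%N = (-1) ^+ y :> R.
Proof.
transitivity (\prod_(x < n | (x < y)%N) (-1) : R).
  rewrite [LHS]big_mkcond [RHS]big_mkcond; apply: eq_bigr => x _ /=.
  by rewrite -(inj_eq val_inj); case: ltngtP.
by rewrite -(big_ord_widen n (fun=> -1)) 1?ltnW // prodr_const card_ord.
Qed.

(* [s] lists a k-subset in increasing order, then its complement in increasing
   order. *)
Definition shuffle (k m : nat) (s : 'S_(k + m)) : Prop :=
  {homo (fun p : 'I_k => s (lshift m p)) : p q / (p < q)%N} /\
  {homo (fun p : 'I_m => s (rshift k p)) : p q / (p < q)%N}.

Lemma homo_ltn_mono (k n : nat) (h : 'I_k -> 'I_n) :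
  {homo h : p q / (p < q)%N} -> {mono h : p q / (p < q)%N}.
Proof.
move=> hh p q; case: (ltngtP p q) => [/hh //|/hh|/val_inj ->]; last by rewrite ltnn.
by move/ltnW; rewrite leqNgt => /negbTE.
Qed.

(** Only a front position and a back position can form an inversion. Of the [s (lshift m p)] values
    below the one at front position [p], exactly [p] sit in front, so the inversions at [p] have the
    parity of [p + s (lshift m p)]. *)
Lemma sign_shuffle (R : realDomainType) (k m : nat) (s : 'S_(k + m)) :
  shuffle s ->
  (-1) ^+ s = \prod_(p < k) (-1) ^+ (p + s (lshift m p)) :> R.
Proof.
case=> /homo_ltn_mono monl /homo_ltn_mono monr.
rewrite sign_perm_inversions big_split_ord /= [X in _ * X]big1 ?mulr1; last first.
  move=> p _; rewrite big_split_ord /= big1 ?mul1r; last first.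
    by move=> q; rewrite ltnNge ltnW // (leq_trans (ltn_ord q)) ?leq_addr.
  by apply: big1 => q; rewrite ltn_add2l monr; case: ltngtP.
apply: eq_bigr => p _; rewrite big_split_ord /= big1 ?mul1r; last first.
  by move=> q; rewrite monl; case: ltngtP.
rewrite exprD -(@prod_sign_ltn R _ (s _)) (reindex_inj (@perm_inj _ s)) /=.
rewrite big_split_ord /=.
under [X in _ = _ * (X * _)]eq_bigl do rewrite (inj_eq perm_inj) (inj_eq (@lshift_inj _ _)).
under [X in _ = _ * (X * _)]eq_bigr do rewrite monl.
rewrite prod_sign_ltn mulrA -expr2 sqrr_sign mul1r; apply: eq_bigl => q /=.
rewrite (inj_eq perm_inj) eq_rlshift.
by rewrite (leq_trans (ltn_ord p)) ?leq_addr.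
Qed.

(* With [s] and [t] bringing the chosen rows and columns to the front, this is
   Jacobi's identity for complementary minors of [B = A^-1]. *)
Lemma det_ulsubmx_inverse (R : comPzRingType) (k m : nat) (A B : 'M[R]_(k + m)) :
  B *m A = 1%:M -> \det (ulsubmx B) = \det B * \det (drsubmx A).
Proof.
rewrite -{1}[B]submxK -{1}[A]submxK mulmx_block scalar_mx_block.
case/eq_block_mx => _ B1 _ B2.
(* Replacing the left block column of [A] by that of the identity gives a matrix of determinant
   [\det (drsubmx A)]; its product with [B] is lower block triangular with diagonal blocks
   [ulsubmx B] and 1. *)
rewrite -[X in _ * X]mul1r -[X in _ * (X * _)](det1 R k).
rewrite -(det_ublock 1%:M (ursubmx A)) -[X in \det X * _]submxK -det_mulmx mulmx_block !mulmx1 !mulmx0 !addr0 B1 B2.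
by rewrite det_lblock det1 mulr1.
Qed.

Lemma det_minor_complement (R : realDomainType) (k m : nat)
    (A B : 'M[R]_(k + m)) (s t : 'S_(k + m)) :
  shuffle s -> shuffle t -> \det B = 1 -> B *m A = 1%:M ->
  \det (\matrix_(p < k, q < k) B (s (lshift m p)) (t (lshift m q))) =
  \det (\matrix_(p < m, q < m)
    ((-1) ^+ (t (rshift k p) + s (rshift k q)) *
      A (t (rshift k p)) (s (rshift k q)))).
Proof.
move=> ss st detB BA.
pose B' := row_perm s (col_perm t B); pose A' := row_perm t (col_perm s A).
have BA' : B' *m A' = 1%:M.
  rewrite /B' /A' !row_permE !col_permE -!mulmxA.
  rewrite (mulmxA (perm_mx t^-1)) -perm_mxM mulVg perm_mx1 mul1mx.
  by rewrite (mulmxA B) BA mul1mx -perm_mxM mulgV perm_mx1.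
transitivity (\det (ulsubmx B')).
  by congr (\det _); apply/matrixP => p q; rewrite !mxE.
rewrite (det_ulsubmx_inverse BA').
have -> : \det B' = (-1) ^+ s * (-1) ^+ t.
  by rewrite /B' row_permE col_permE !det_mulmx !det_perm detB mul1r odd_permV.
(* Multiplying by [D t] and [D s] produces the checkerboard signs. Each determinant is the product
   of all signs in the window times that over the front values, which [sign_shuffle] evaluates; the
   factors common to [s] and [t] square to 1. *)
pose D (u : 'S_(k + m)) : 'M[R]_m := diag_mx (\row_q (-1) ^+ u (rshift k q)).
have detD u : shuffle u -> \det (D u) =
    \prod_(p < k) (-1) ^+ p * (-1) ^+ u * \prod_(i < k + m) (-1) ^+ i.
  move=> su; rewrite det_diag (reindex_inj (@perm_inj _ u)) big_split_ord /=.
  rewrite (sign_shuffle R su) mulrA -!big_split /= [X in _ = X * _]big1 ?mul1r => [|p _].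
    by apply: eq_bigr => q _; rewrite mxE.
  by rewrite -!exprD -signr_odd !oddD; do 2!case: (odd _).
set M := (X in _ = \det X).
have -> : M = D t *m drsubmx A' *m D s.
  apply/matrixP => p q; rewrite mul_diag_mx mul_mx_diag !mxE exprD.

  by rewrite mulrAC.
rewrite !(@det_mulmx R) !detD // mulrC.
set d := \det _; set P := \prod_(p < k) _; set Q := \prod_(i < _) _.
have P2 : P * P = 1.
  by rewrite -big_split big1 //= => i _; rewrite -expr2 sqrr_sign.
have Q2 : Q * Q = 1.
  by rewrite -big_split big1 //= => i _; rewrite -expr2 sqrr_sign.
transitivity ((P * P) * (Q * Q) * (d * ((-1) ^+ s * (-1) ^+ t))).
  by rewrite P2 Q2 !mul1r.
set u := (-1) ^+ s; set v := (-1) ^+ t; ring.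
Qed.

(** * Completing index sets to shuffles *)

Lemma exists_shuffle (k m : nat) (r : 'I_k -> 'I_(k + m)) :
  {homo r : p q / (p < q)%N} ->
  exists2 s : 'S_(k + m), shuffle s & forall p, s (lshift m p) = r p.
Proof.
move=> homr; have monr := homo_ltn_mono homr.
have injr : injective r.
  move=> p q pq; apply: val_inj; have := monr p q; have := monr q p.
  by rewrite pq ltnn; case: ltngtP.
pose C := ~: [set r p | p in 'I_k].
have cardC : m = #|C|.
  by rewrite cardsCs setCK card_imset // !card_ord addKn.
pose c (q : 'I_m) : 'I_(k + m) := Order.enum_val (cast_ord cardC q).
have homc : {homo c : p q / (p < q)%N}.
  move=> p q pq; rewrite ltnNge.
  have := Order.le_enum_val (@le_total _ 'I_(k + m)) (cast_ord cardC q) (cast_ord cardC p).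
  by rewrite !leEord /= => ->; rewrite -ltnNge.
have injc : injective c by move=> p q /Order.EnumVal.enum_val_inj /cast_ord_inj.
have rc p q : r p != c q.
  have := Order.EnumVal.enum_valP (cast_ord cardC q); rewrite inE.
  by apply: contraNneq => rpcq; apply/imsetP; exists p.
pose h i := match split i with inl p => r p | inr q => c q end.
have injh : injective h.
  move=> i j; rewrite /h; case: splitP => p ip; case: splitP => q jq pq.
  - by apply: val_inj; rewrite /= ip jq (injr _ _ pq).
  - by move: (rc p q); rewrite pq eqxx.
  - by move: (rc q p); rewrite pq eqxx.
  - by apply: val_inj; rewrite /= ip jq (injc _ _ pq).
have hl p : perm injh (lshift m p) = r p.
  by rewrite permE /h (unsplitK (inl p)).
have hr q : perm injh (rshift k q) = c q.
  by rewrite permE /h (unsplitK (inr q)).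
exists (perm injh); last exact: hl.
by split=> p q pq; rewrite ?hl ?hr; [apply: homr | apply: homc].
Qed.

(** The window starts at [-B]. Length [B + B] would already contain all indices; the extra [k] makes
    the complement have size [B + B] without any subtraction. *)
Lemma increasing_shuffle (k B : nat) (r : 'I_k -> int) :
  increasing r -> (forall p, `|r p| < B)%N ->
  exists2 s : 'S_(k + (B + B)), shuffle s &
    forall p, r p = (s (lshift (B + B) p))%:Z - B%:Z.
Proof.
move=> incr rB.
have bound p : (`|(r p + B%:Z)%R| < k + (B + B))%N by have := rB p; lia.
pose r' p := Ordinal (bound p).
have [|s ss sr] := @exists_shuffle k (B + B) r'.
  by move=> p q /incr; have := rB p; have := rB q; rewrite /=; lia.
by exists s => // p; rewrite sr /=; have := rB p; lia.
Qed.

(** * Finite sections of Toeplitz matrices *)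

Definition toeplitz_mx (R : realType) (n : nat) (f : fps R) : 'M[R]_n :=
  \matrix_(i < n, j < n) toeplitz f i j.

Lemma toeplitz_nat (R : realType) (f : fps R) (i j : nat) :
  toeplitz f i j = if (i <= j)%N then f (j - i)%N else 0.
Proof.
rewrite /toeplitz subr_ge0 lez_nat; case: leqP => // ij.
by congr (f _); lia.
Qed.

Lemma toeplitz_shift (R : realType) (f : fps R) (a i j : int) :
  toeplitz f (i + a) (j + a) = toeplitz f i j.
Proof.
by rewrite /toeplitz (_ : j + a - (i + a) = j - i); last lia.
Qed.

(** Truncation loses nothing: by triangularity only intermediate indices between [i] and [j]
    contribute, and these lie in the section. *)
Lemma mul_toeplitz_mx (R : realType) (n : nat) (f g : fps R) :
  toeplitz_mx n f *m toeplitz_mx n g = toeplitz_mx n (fps_mul f g).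
Proof.
apply/matrixP => i j; rewrite !mxE.
under eq_bigr do rewrite !mxE !toeplitz_nat.
rewrite -(big_mkord xpredT (fun l => (if (i <= l)%N then f (l - i)%N else 0) *
  (if (l <= j)%N then g (j - l)%N else 0))).
rewrite toeplitz_nat; case: leqP => ij; last first.
  apply: big1 => l _; case: leqP => il; rewrite ?mul0r //.
  by rewrite ifF ?mulr0 //; lia.
rewrite (@big_cat_nat _ _ _ i) //= 1?ltnW // big_nat big1 ?add0r; last first.
  by move=> l /andP[_ li]; rewrite ifF ?mul0r //; lia.
rewrite (@big_cat_nat _ _ _ j.+1) //=; last by lia.
rewrite [X in _ + X]big_nat [X in _ + X]big1 ?addr0; last first.
  by move=> l /andP[lj _]; rewrite [X in _ * X]ifF ?mulr0 //; lia.
rewrite -{1}[nat_of_ord i]add0n big_addn subSn // big_mkord /fps_mul.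
apply: eq_bigr => l _; have lt_l := ltn_ord l.
rewrite !ifT; [|lia..].
by congr (f _ * g _); lia.
Qed.

Lemma toeplitz_mx1 (R : realType) (n : nat) (h : fps R) :
  h =1 @fps_one R -> toeplitz_mx n h = 1%:M.
Proof.
move=> h1; apply/matrixP => i j; rewrite !mxE toeplitz_nat h1 /fps_one.
by rewrite -(inj_eq val_inj) subn_eq0 eqn_leq; case: leqP.
Qed.

Lemma det_toeplitz_mx (R : realType) (n : nat) (f : fps R) :
  \det (toeplitz_mx n f) = f 0%N ^+ n.
Proof.
rewrite -det_tr det_trig.
  under eq_bigr do rewrite !mxE toeplitz_nat leqnn subnn.
  by rewrite prodr_const card_ord.
apply/is_trig_mxP => i j ij; rewrite !mxE toeplitz_nat ifF //; lia.
Qed.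

Lemma toeplitz_reflect (R : realType) (f : fps R) (i j : nat) :
  toeplitz (fps_reflect f) i j = (-1) ^+ (i + j) * toeplitz f i j.
Proof.
rewrite !toeplitz_nat; case: leqP => ij; rewrite ?mulr0 // /fps_reflect.
by rewrite -signr_odd oddB // addbC -oddD signr_odd.
Qed.

(** * Transfer of total positivity *)

Lemma totally_positive_inv_reflect (R : realType) (f g : fps R) :
  g 0%N = 1 -> fps_is_inv g (fps_reflect f) ->
  totally_positive (toeplitz f) -> totally_positive (toeplitz g).
Proof.
move=> g0 ginv tpf k r c k0 incr incc.
(* One bound for rows and columns puts both in the same window; the successor makes it strict and
   also makes [m] positive below. *)
pose B := (\sum_p (`|r p| + `|c p|)).+1%N.
have rB p : (`|r p| < B)%N by rewrite /B (bigD1 p) //=; lia.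
have cB p : (`|c p| < B)%N by rewrite /B (bigD1 p) //=; lia.
have [s ss sr] := increasing_shuffle incr rB.
have [t st tc] := increasing_shuffle incc cB.
set m := (B + B)%N in s t ss st sr tc.
have detg : \det (toeplitz_mx (k + m) g) = 1 by rewrite det_toeplitz_mx g0 expr1n.
have gf : toeplitz_mx (k + m) g *m toeplitz_mx (k + m) (fps_reflect f) = 1%:M.
  by rewrite mul_toeplitz_mx toeplitz_mx1.
have := det_minor_complement ss st detg gf.
rewrite (_ : \det _ = minor (toeplitz g) r c); last first.
  congr (\det _); apply/matrixP => p q.
  by rewrite !mxE sr tc toeplitz_shift.
move->.
have incb (u : 'S_(k + m)) : shuffle u ->
    increasing (fun q : 'I_m => (u (rshift k q))%:Z).
  by case=> _ homu p q pq; rewrite ltz_nat homu.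
(* Rows come from the complement of the columns [c], and columns from that of the rows [r]. *)
have := tpf m _ _ isT (incb _ st) (incb _ ss).
congr (0 <= \det _); apply/matrixP => p q.
by rewrite !mxE toeplitz_reflect mulrA -expr2 sqrr_sign mul1r.
Qed.

(** Substituting -z for z in g(z) f(-z) = 1 gives g(-z) f(z) = 1; reversing the convolution sum
    swaps the factors. *)
Lemma fps_is_inv_reflect (R : realType) (f g : fps R) :
  fps_is_inv g (fps_reflect f) -> fps_is_inv f (fps_reflect g).
Proof.
move=> ginv n.
transitivity ((-1) ^+ n * fps_one R n); last first.
  by case: n => [|n]; rewrite /fps_one ?mulr0 ?expr0 ?mul1r.
rewrite -ginv /fps_mul mulr_sumr (reindex_inj rev_ord_inj) /=.
apply: eq_bigr => i _; have := ltn_ord i; rewrite ltnS => le_in.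
rewrite /fps_reflect subSS subKn //.
have -> : (-1) ^+ i = (-1) ^+ n * (-1) ^+ (n - i) :> R.
  by rewrite -exprD -signr_odd -[RHS]signr_odd oddD oddB // addbA addbb.
set a := (-1) ^+ n; set b := (-1) ^+ (n - i); ring.
Qed.

Unset Implicit Arguments.

Theorem mainTheorem2 (R : realType) (f g : fps R)
    (f0 : f 0%N = 1%R) (g0 : g 0%N = 1%R)
    (g_inv : fps_is_inv g (fps_reflect f)) :
  totally_positive (toeplitz f) <-> totally_positive (toeplitz g).
Proof.
split; first exact: totally_positive_inv_reflect.
exact: totally_positive_inv_reflect (fps_is_inv_reflect g_inv).
Qed.
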